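(* Let $\rho:\mathcal Z\to\mathbb R$ be a law invariant coherent risk measure on $\mathcal Z=L_p(\Omega,\mathcal F,P)$, $p\in[1,\infty)$, where $(\Omega,\mathcal F,P)$ is $[0,1]$ with its Borel sigma-algebra and the uniform probability measure. Let $\mathfrak M\subset\mathfrak P$ be a Kusuoka set of $\rho$ and $\overline{\mathfrak M}$ its topological closure. Then the augmented set $$\{\mu'\in\mathfrak P:\ \mu'\preceq\mu\ \text{for some }\mu\in\mathfrak M\}$$ is a Kusuoka set of $\rho$ as well. Furthermore, the set $$\mathfrak M':=\{\mu\in\overline{\mathfrak M}:\ \text{there is no }\nu\in\mathfrak M\text{ with }\mu\prec\nu\}$$ is a Kusuoka set of $\rho$.
   Context: For $Z\in\mathcal Z$, $F_Z(z)=P(Z\le z)$ and $F_Z^{-1}(\tau)=\sup\{t:F_Z(t)\le\tau\}$. A coherent risk measure is a functional $\rho:\mathcal Z\to\mathbb R$ that is monotone ($Z\ge Z'$ a.e. implies $\rho(Z)\ge\rho(Z')$), convex, translation equivariant ($\rho(Z+a)=\rho(Z)+a$ for $a\in\mathbb R$) and positively homogeneous ($\rho(tZ)=t\rho(Z)$ for $t\ge0$). It is law invariant if $F_{Z_1}=F_{Z_2}$ implies $\rho(Z_1)=\rho(Z_2)$. $\mathfrak P$ is the set of probability measures on $[0,1]$ with zero mass at $1$, with the weak topology of probability measures (closures are taken in $\mathfrak P$). A measure $\mu$ is identified with its distribution function $\mu(\alpha)=\mu((-\infty,\alpha])$, $\alpha\in\mathbb R$; integrals $\int_0^1\cdot\,d\mu$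 include the mass at $0$. First order stochastic dominance: $\mu_1\preceq\mu_2$ means $\mu_1(\alpha)\ge\mu_2(\alpha)$ for all $\alpha\in\mathbb R$; $\mu_1\prec\mu_2$ means $\mu_1\preceq\mu_2$ and $\mu_1\ne\mu_2$. $\mathrm{AV@R}_\alpha(Z)=(1-\alpha)^{-1}\int_\alpha^1F_Z^{-1}(\tau)\,d\tau$, $\alpha\in[0,1)$. A set $\mathfrak M\subset\mathfrak P$ is a Kusuoka set of $\rho$ if $\rho(Z)=\sup_{\mu\in\mathfrak M}\int_0^1\mathrm{AV@R}_\alpha(Z)\,d\mu(\alpha)$ for all $Z\in\mathcal Z$. *)

(* Defs.v *)
From HB Require Import structures.
From mathcomp Require Import all_boot all_order all_algebra.
From mathcomp Require Import all_classical all_reals all_analysis.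
From mathcomp Require Import measurable_realfun giry.

Set Implicit Arguments.
Unset Strict Implicit.
Unset Printing Implicit Defensive.

Import Order.TTheory GRing.Theory Num.Theory.
Import numFieldNormedType.Exports.

Local Open Scope classical_set_scope.
Local Open Scope ring_scope.

Definition unit_interval (R : realType) : Type := set_type (`[0, 1]%classic : set R).

Section unit_interval_structures.
Variable R : realType.
Local Notation I := (unit_interval R).

HB.instance Definition _ := Topological.copy I (set_type (`[0, 1]%classic : set R)).

Definition ui_val (x : I) : R := set_val x.

Lemma ui_val_inj : injective ui_val.
Proof. exact: val_inj. Qed.

Lemma ui_valP (x : I) : ui_val x \in (`[0, 1]%classic : set R).
Proof. exact: valP. Qed.

Lemma zero_in_unit_interval : (0 : R) \in (`[0, 1]%classic : set R).
Proof. by rewrite inE /= in_itv /= lexx ler01. Qed.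

HB.instance Definition _ :=
  isPointed.Build I (exist _ (0 : R) zero_in_unit_interval).

(* Measurable sets of [0, 1]: traces on [0, 1] of the Borel sets of R;
   [ui_measurableE] identifies them with the Borel sigma-algebra of the
   topological space [0, 1]. *)
Definition ui_measurable : set (set I) :=
  preimage_set_system setT ui_val (@measurable _ (measurableTypeR R)).

Lemma ui_sigma_algebra : sigma_algebra setT ui_measurable.
Proof.
exact: sigma_algebra_preimage (sigma_algebra_measurable (measurableTypeR R)).
Qed.

Let ui_measurable0 : ui_measurable set0.
Proof. by have [] := ui_sigma_algebra. Qed.

Let ui_measurableC A : ui_measurable A -> ui_measurable (~` A).
Proof. by move=> mA; rewrite -setTD; have [_ + _] := ui_sigma_algebra; apply. Qed.

Let ui_measurableU (F : (set I)^nat) :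
  (forall i, ui_measurable (F i)) -> ui_measurable (\bigcup_i F i).
Proof. by have [_ _] := ui_sigma_algebra; apply. Qed.

Definition ui_display : measure_display. Proof. by constructor. Qed.

HB.instance Definition _ := @isMeasurable.Build ui_display I ui_measurable
  ui_measurable0 ui_measurableC ui_measurableU.

Lemma ui_measurableE : ui_measurable = <<s (@open I) >>.
Proof.
apply/seteqP; split; last first.
  apply: smallest_sub; first exact: ui_sigma_algebra.
  move=> _ [B oB <-]; exists B; first exact: open_measurable.
  by rewrite setTI.
have mE : @measurable _ (measurableTypeR R) =
    (@RGenOpens.G R).-sigma.-measurable := @RGenOpens.measurableE R.
rewrite /ui_measurable mE -g_sigma_preimageE.
apply: sub_sigma_algebra2 => _ [_ [x [y ->]] <-].
by exists `]x, y[%classic; [exact: interval_open|rewrite setTI].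
Qed.

Lemma measurable_ui_image (A : set I) :
  measurable A -> measurable (ui_val @` A : set (measurableTypeR R)).
Proof.
move=> [B mB <-].
rewrite setTI (_ : _ @` _ = B `&` `[0, 1]%classic); first exact: measurableI.
apply/seteqP; split=> [_ [x Bx <-]|r [Br r01]].
  by split=> //; exact: set_mem (ui_valP x).
by exists (exist _ r (mem_set r01)).
Qed.

Definition ui_uniform (A : set I) : \bar R :=
  lebesgue_measure (ui_val @` A).

Let ui_uniform0 : ui_uniform set0 = 0%E.
Proof. by rewrite /ui_uniform image_set0 measure0. Qed.

Let ui_uniform_ge0 A : (0 <= ui_uniform A)%E.
Proof. exact: measure_ge0. Qed.

Let ui_uniform_sigma_additive : semi_sigma_additive ui_uniform.
Proof.
move=> F mF tF mUF; rewrite /ui_uniform image_bigcup.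
apply: (@measure_semi_sigma_additive _ _ _ lebesgue_measure).
- by move=> i; exact: measurable_ui_image.
- move=> i j _ _ [_ [[x Fx <-] [y Fy /ui_val_inj yx]]].
  by apply: (tF i j) => //; exists x; split=> //; rewrite -yx.
- by rewrite -image_bigcup; exact: measurable_ui_image.
Qed.

HB.instance Definition _ := isMeasure.Build _ I R ui_uniform
  ui_uniform0 ui_uniform_ge0 ui_uniform_sigma_additive.

Let ui_uniform_setT : ui_uniform setT = 1%E.
Proof.
rewrite /ui_uniform (_ : _ @` _ = `[0, 1]%classic).
  by rewrite lebesgue_measure_itv /= lte_fin ltr01 sube0.
apply/seteqP; split=> [_ [x _ <-]|r r01]; first exact: set_mem (ui_valP x).
by exists (exist _ r (mem_set r01)).
Qed.

HB.instance Definition _ :=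
  Measure_isProbability.Build _ I R ui_uniform ui_uniform_setT.

End unit_interval_structures.

Arguments ui_uniform : clear implicits.

(* Elements of L_p are represented by functions; a functional that is monotone
   with respect to the a.e. order only depends on the a.e. class. *)
Section risk_measures.
Context d (T : measurableType d) (R : realType) (P : probability T R).
Variables (p : R) (p1 : (1 <= p%:E)%E).
Local Notation Lp := (LfunType P p1).

Definition Lp_cst (a : R) : Lp := Lfun_Sub p1 (Lfun_cst P a p).

Definition coherent_risk_measure (rho : Lp -> R) : Prop :=
  [/\ forall Z Z' : Lp, {ae P, forall x, Z' x <= Z x} -> rho Z' <= rho Z,
      forall (Z Z' : Lp) (t : R), 0 <= t <= 1 ->
        rho (t *: Z + (1 - t) *: Z') <= t * rho Z + (1 - t) * rho Z',
      forall (Z : Lp) (a : R), rho (Z + Lp_cst a) = rho Z + a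
    & forall (Z : Lp) (t : R), 0 <= t -> rho (t *: Z) = t * rho Z].

Definition law_invariant (rho : Lp -> R) : Prop :=
  forall Z1 Z2 : Lp, (forall z, cdf (Z1 : {RV P >-> R}) z =
                                cdf (Z2 : {RV P >-> R}) z) ->
    rho Z1 = rho Z2.

Definition quantile (Z : Lp) (tau : R) : \bar R :=
  ereal_sup [set t%:E | t in [set t | (cdf (Z : {RV P >-> R}) t <= tau%:E)%E]].

Definition AVaR (alpha : R) (Z : Lp) : \bar R :=
  ((1 - alpha)^-1%:E *
    \int[lebesgue_measure]_(tau in `[alpha, 1%R]) quantile Z tau)%E.

(* AVaR is meant for alpha < 1; its junk value at alpha = 1 is not seen by
   measures without mass at 1. *)
Definition mixed_AVaR (mu : probability (unit_interval R) R) (Z : Lp) : \bar R :=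
  (\int[mu]_a AVaR (ui_val a) Z)%E.

End risk_measures.

Section measures_on_unit_interval.
Variable R : realType.
Local Notation I := (unit_interval R).

Definition frakP : set (probability I R) :=
  [set mu | mu [set x | ui_val x = 1] = 0%E].

Definition dfun (mu : probability I R) (a : R) : \bar R :=
  mu [set x | ui_val x <= a].

Definition fsd (mu1 mu2 : probability I R) : Prop :=
  forall a, (dfun mu2 a <= dfun mu1 a)%E.

(* Equality of measures is equality on measurable sets: the library's measures
   also carry (arbitrary) values on the other sets, so Leibniz equality would be
   too fine. *)
Definition fsd_strict (mu1 mu2 : probability I R) : Prop :=
  fsd mu1 mu2 /\ ~ measure_eq mu1 mu2.

(* The coarsest topology making mu |-> \int f dmu continuous for every
   continuous f : [0, 1] -> R (such an f is bounded, [0, 1] being compact). *)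
Definition integrals_of_continuous (mu : probability I R) :
    {ptws continuousType I R -> R} :=
  fun f => \int[mu]_x f x.

Definition weak_probability : topologicalType :=
  initial_topology integrals_of_continuous.

(* closure in frakP, i.e. for the subspace topology *)
Definition frakP_closure (M : set (probability I R)) : set (probability I R) :=
  closure (M : set weak_probability) `&` frakP.

End measures_on_unit_interval.

Definition Kusuoka_set d (T : measurableType d) (R : realType)
    (P : probability T R) (p : R) (p1 : (1 <= p%:E)%E)
    (rho : LfunType P p1 -> R) (M : set (probability (unit_interval R) R)) :
    Prop :=
  M `<=` @frakP R /\
  forall Z : LfunType P p1,
    (rho Z)%:E = ereal_sup [set mixed_AVaR mu Z | mu in M].

(* Main.v *)
Require Import Defs.
From HB Require Import structures.
From mathcomp Require Import all_boot all_order all_algebra.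
From mathcomp Require Import all_classical all_reals all_analysis.
From mathcomp Require Import measurable_realfun giry ring lra.

(* For [Z] in L_p, [a |-> AVaR a Z] is continuous and nondecreasing on [0, 1[,
   hence the increasing limit of the continuous functions
   [a |-> AVaR (min a (1 - 1/(n+1))) Z] on [0, 1].  Coupling two measures
   through their quantile functions on [0, 1] shows that their integrals are
   monotone for [fsd], and so is [mixed_AVaR]; this gives the first claim.
   Weak limits preserve upper bounds on the same integrals, so a measure in the
   closure of [M] has [mixed_AVaR mu Z <= rho Z], and it has no mass at [1]
   because L_p contains unbounded functions.
   It remains to dominate every [mu] in [M] by a measure of the closure that no
   element of [M] strictly dominates.  Zorn's lemma can be avoided: choose an
   increasing sequence in [M] starting at [mu], the mean of each [mu_ (n+1)] being
   within [1/(n+1)] of the supremum of the means available above [mu_ n].  The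
   quantile functions increase to a limit, whose law is the weak limit of the
   sequence; an element of [M] above it has no larger mean, hence, by the
   coupling, the same law. *)

Set Implicit Arguments.
Unset Strict Implicit.
Unset Printing Implicit Defensive.

Import Order.TTheory GRing.Theory Num.Theory.
Import numFieldNormedType.Exports.

Local Open Scope classical_set_scope.
Local Open Scope ring_scope.

(** * Measurability, topology and uniform measure on [0, 1] *)

Section unit_interval_facts.
Variable R : realType.
Local Notation I := (unit_interval R).
Local Notation U := (ui_uniform R).

Lemma ui_val_itv (u : I) : 0 <= ui_val u <= 1.
Proof. by have := set_mem (ui_valP u); rewrite /= in_itv. Qed.

Lemma measurable_ui_val : measurable_fun setT (@ui_val R).
Proof. by move=> _ B mB; rewrite setTI; exists B => //; rewrite setTI. Qed.

HB.instance Definition _ :=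
  isMeasurableFun.Build _ _ _ _ (@ui_val R) measurable_ui_val.

Lemma measurable_ui_eq x : measurable [set u : I | ui_val u = x].
Proof.
have := measurable_ui_val measurableT (measurable_set1 x).
by rewrite setTI.
Qed.

Lemma continuous_ui_val : continuous (@ui_val R).
Proof. exact: (@initial_continuous _ _ (@set_val R `[0, 1]%classic)). Qed.

Definition clamp01 (x : R) : R := Num.max 0 (Num.min x 1).

Lemma clamp01_itv x : 0 <= clamp01 x <= 1.
Proof. by rewrite /clamp01 le_max lexx ge_max ler01 ge_min lexx orbT. Qed.

Lemma clamp01_mem x : clamp01 x \in (`[0, 1]%classic : set R).
Proof. by rewrite inE /= in_itv clamp01_itv. Qed.

Lemma clamp01_id x : 0 <= x <= 1 -> clamp01 x = x.
Proof. by case/andP=> x0 x1; rewrite /clamp01 (min_idPl x1) (max_idPr x0). Qed.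

Lemma clamp01_le x y : x <= y -> clamp01 x <= clamp01 y.
Proof.
move=> xy; rewrite /clamp01 ge_max !le_max lexx /=; apply/orP; right.
by rewrite le_min !ge_min xy lexx !orbT.
Qed.

(** A total left inverse of [ui_val]: it builds points of [I] without carrying membership proofs,
    and turns functions on [0, 1] into functions on R. *)
Definition ui_clamp (x : R) : I := exist _ (clamp01 x) (clamp01_mem x).

Lemma ui_clampE x : ui_val (ui_clamp x) = clamp01 x.
Proof. by []. Qed.

Lemma ui_valK : cancel (@ui_val R) ui_clamp.
Proof.
move=> u; apply: ui_val_inj.
by rewrite ui_clampE clamp01_id// ui_val_itv.
Qed.

Lemma measurable_ui_clamp : measurable_fun setT ui_clamp.
Proof.
move=> _ _ [B mB <-]; rewrite !setTI.
rewrite (_ : _ @^-1` _ = setT `&` clamp01 @^-1` B); last by rewrite setTI.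
apply: (_ : measurable_fun setT clamp01) => //.
by apply: measurable_maxr => //; apply: measurable_minr.
Qed.

Lemma measurable_ui_le x : measurable [set u : I | ui_val u <= x].
Proof.
rewrite -[X in measurable X]setTI
  (_ : [set _ | _] = @ui_val R @^-1` `]-oo, x]%classic).
  exact: measurable_ui_val.
by apply/seteqP; split => u /=; rewrite in_itv.
Qed.

Lemma ui_uniform_le x : 0 <= x <= 1 -> U [set u | ui_val u <= x] = x%:E.
Proof.
case/andP => x0 x1; rewrite /U /= /ui_uniform (_ : _ @` _ = `[0, x]%classic).
  rewrite lebesgue_measure_itv /= lte_fin.
  by case: ltgtP x0 => // [_|<-]; rewrite ?sube0.
apply/seteqP; split=> [_ [u /= ux <-]|r /=]; rewrite in_itv /=.
  by rewrite ux andbT; have /andP[] := ui_val_itv u.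
by case/andP => r0 rx; exists (ui_clamp r);
  rewrite /mkset ui_clampE clamp01_id// r0 (le_trans rx).
Qed.

Lemma ui_uniform_lt x : 0 <= x <= 1 -> U [set u | ui_val u < x] = x%:E.
Proof.
case/andP => x0 x1; rewrite /U /= /ui_uniform (_ : _ @` _ = `[0, x[%classic).
  rewrite lebesgue_measure_itv /= lte_fin.
  by case: ltgtP x0 => // [_|<-]; rewrite ?sube0.
apply/seteqP; split=> [_ [u /= ux <-]|r /=]; rewrite in_itv /=.
  by rewrite ux andbT; have /andP[] := ui_val_itv u.
by case/andP => r0 rx; exists (ui_clamp r);
  rewrite /mkset ui_clampE clamp01_id// r0 ltW// (lt_le_trans rx).
Qed.

Lemma measurable_ui_lt x : measurable [set u : I | ui_val u < x].
Proof.
rewrite -[X in measurable X]setTI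
  (_ : [set _ | _] = @ui_val R @^-1` `]-oo, x[%classic).
  exact: measurable_ui_val.
by apply/seteqP; split => u /=; rewrite in_itv.
Qed.

Lemma ui_uniform_eq0 x : U [set u | ui_val u = x] = 0%E.
Proof.
rewrite /U /= /ui_uniform; apply/eqP; rewrite -measure_le0.
have <- : lebesgue_measure [set x] = 0%E :> \bar R.
  exact: lebesgue_measure_set1.
apply: le_outer_measure; first by move=> _ [u /= <- <-].
Qed.

(** Closed lower half-lines are stable under intersection, generate the Borel sets and cover R
    through []-oo, n]], so uniqueness of measures applies. *)
Lemma probability_eq_cdf (P Q : probability R R) :
  (forall x, P `]-oo, x]%classic = Q `]-oo, x]%classic) ->
  forall A, measurable A -> P A = Q A.
Proof.
move=> PQ A mA.
apply: (@measure_unique _ R R [set A | exists x, A = `]-oo, x]%classic]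
  (fun n => `]-oo, n%:R]%classic) _ _ _ _ P Q) => //.
- rewrite [LHS](@RGenOInfty.measurableE R); apply/seteqP; split.
    apply: smallest_sub; first exact: smallest_sigma_algebra.
    move=> _ [x ->]; rewrite -setCitvl; apply: sigma_algebraC.
    by apply: sub_sigma_algebra; exists x.
  apply: smallest_sub; first exact: smallest_sigma_algebra.
  move=> _ [x ->]; rewrite -setCitvr; apply: sigma_algebraC.
  by apply: sub_sigma_algebra; exists x.
- move=> _ _ [x ->] [y ->]; exists (Num.min x y).
  by apply/seteqP; split => r /=; rewrite !in_itv /= le_min => /andP.
- by move=> i; exists i%:R.
- rewrite -subTset => t _/=.
  by exists (Num.truncn t).+1; rewrite //= in_itv/= ltW// truncnS_gt.
- by move=> _ [x ->]; exact: PQ.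
- by move=> k; rewrite (le_lt_trans (probability_le1 _ _))// ltry.
Qed.

End unit_interval_facts.

(** * Quantile functions under the uniform measure *)

Section quantile_transform.
Context d (T : measurableType d) (R : realType) (P : probability T R).
Variable X : {RV P >-> R}.
Local Notation I := (unit_interval R).
Local Notation U := (ui_uniform R).

(** The formula of [quantile] for an arbitrary [F]: besides elements of L_p, it serves for [ui_val]
    under a probability measure on [0, 1]. *)
Definition gen_inverse (F : R -> \bar R) (tau : R) : \bar R :=
  ereal_sup [set t%:E | t in [set t | (F t <= tau%:E)%E]].

Local Notation Q := (gen_inverse (cdf X)).

Lemma gen_inverse_nd (s t : R) : s <= t -> (Q s <= Q t)%E.
Proof.
move=> st; apply: le_ereal_sup; apply: image_subset => x /= Fx.
by rewrite (le_trans Fx)// lee_fin.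
Qed.

Lemma gen_inverse_ge (x t : R) : (cdf X x <= t%:E)%E -> (x%:E <= Q t)%E.
Proof. by move=> Fx; apply: ereal_sup_ubound; exists x. Qed.

Lemma gen_inverse_le (x t : R) : (t%:E < cdf X x)%E -> (Q t <= x%:E)%E.
Proof.
move=> tFx; apply: ge_ereal_sup => _ [y /= Fy <-]; rewrite lee_fin leNgt.
apply/negP => xy; have := cdf_nondecreasing X (ltW xy).
by rewrite leNgt (le_lt_trans Fy tFx).
Qed.

(** By right continuity, [cdf X x < t] would persist at some [y > x], which would force
    [Q t >= y > x]. *)
Lemma le_cdf_gen_inverse (x t : R) : (Q t <= x%:E)%E -> (t%:E <= cdf X x)%E.
Proof.
move=> Qx; rewrite leNgt; apply/negP => Fxt.
have : \forall y \near x^'+, (cdf X y < t%:E)%E.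
  apply: (@cdf_right_continuous _ _ _ _ X x [set y | (y < t%:E)%E]).
  by apply: open_nbhs_nbhs; split => //; exact: open_ereal_lt_ereal.
move=> /(filterI (nbhs_right_gt x)) /filter_ex [y [xy]] /ltW /gen_inverse_ge yQ.
by have := le_trans yQ Qx; rewrite lee_fin leNgt xy.
Qed.

Lemma gen_inverse_fin_num (t : R) : 0 < t < 1 -> Q t \is a fin_num.
Proof.
case/andP => t0 t1; rewrite fin_numElt; apply/andP; split.
  have : \forall x \near -oo, (cdf X x < t%:E)%E.
    apply: (@cvg_cdfNy0 _ _ _ _ X [set y | (y < t%:E)%E]).
    apply: open_nbhs_nbhs.
    by split; [exact: open_ereal_lt_ereal|rewrite /= lte_fin].
  by case/filter_ex => x /ltW /gen_inverse_ge; exact: lt_le_trans (ltNyr x).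
have : \forall x \near +oo, (t%:E < cdf X x)%E.
  apply: (@cvg_cdfy1 _ _ _ _ X [set y | (t%:E < y)%E]); apply: open_nbhs_nbhs.
  by split; [exact: open_ereal_gt_ereal|rewrite /= lte_fin].
by case/filter_ex => x /gen_inverse_le Qx; exact: le_lt_trans Qx (ltry x).
Qed.

Lemma measurable_gen_inverse : measurable_fun setT Q.
Proof.
apply: (measurability (@ErealGenOInfty.G R)) => [|/= _ [_] [r] -> <-].
  exact: ErealGenOInfty.measurableE.
rewrite setTI; apply: is_interval_measurable => s t/=.
rewrite !in_itv /= !andbT => rQs rQt u /andP[su ut].
by rewrite in_itv /= andbT (lt_le_trans rQs)// gen_inverse_nd.
Qed.

(** The quantile can be infinite only at the endpoints 0 and 1, a null set, where [fine] returns
    0. *)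
Definition quantile_fun (u : I) : R := fine (Q (ui_val u)).

Lemma measurable_quantile_fun : measurable_fun setT quantile_fun.
Proof.
apply: measurableT_comp => //.
apply: (measurableT_comp measurable_gen_inverse); exact: measurable_ui_val.
Qed.

HB.instance Definition _ :=
  isMeasurableFun.Build _ _ _ _ quantile_fun measurable_quantile_fun.

Let measurable_quantile_fun_le x : measurable [set u | quantile_fun u <= x].
Proof.
have := measurable_quantile_fun measurableT (measurable_itv `]-oo, x]).
by rewrite setTI.
Qed.

(** The two endpoints have measure 0, so an inclusion on the open interval suffices. *)
Let U01 (A B : set I) : measurable A -> measurable B ->
  (forall u, 0 < ui_val u < 1 -> A u -> B u) -> (U A <= U B)%E.
Proof.
move=> mA mB AB.
pose N c := [set u : I | ui_val u = c].
have mN c : measurable (N c) by exact: measurable_ui_eq.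
have UN c : U (N c) = 0%E by exact: ui_uniform_eq0.
have -> : U B = (U B + (U (N 0%R) + U (N 1%R)))%E.
  by rewrite !UN !adde0.
apply: (@le_trans _ _ (U (B `|` (N 0%R `|` N 1%R)))).
  rewrite le_measure ?inE//; first by do 2!apply: measurableU => //.
  move=> u Au; have /andP[] := ui_val_itv u.
  rewrite le_eqVlt => /predU1P[u0 _|u0]; first by right; left; exact: esym.
  rewrite le_eqVlt => /predU1P[u1|u1]; first by right; right.
  by left; apply: AB => //; rewrite u0.
rewrite (le_trans (measureU2 _ _ _))// ?leeD2l//; last exact: measureU2.
exact: measurableU.
Qed.

(** The event that the quantile is at most [x] lies between the events [u < cdf X x] and
    [u <= cdf X x], both of uniform measure [cdf X x]. *)
Lemma distribution_quantile_fun (A : set R) : measurable A ->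
  distribution U quantile_fun A = distribution P X A.
Proof.
apply: (@probability_eq_cdf R (distribution U quantile_fun) (distribution P X)).
move=> x; transitivity (cdf X x); last by [].
have Ffin : cdf X x \is a fin_num by exact: fin_num_measure.
have F01 : 0 <= fine (cdf X x) <= 1.
  by rewrite fine_ge0 ?cdf_ge0//= -lee_fin fineK// cdf_le1.
transitivity (U [set u | quantile_fun u <= x]).
  by congr (ui_uniform R _); apply/seteqP; split => u /=; rewrite in_itv.
apply/eqP; rewrite eq_le; apply/andP; split.
  rewrite -(fineK Ffin) -(ui_uniform_le F01); apply: U01;
    [exact: measurable_quantile_fun_le|exact: measurable_ui_le|].
  move=> u u01 /=; rewrite -lee_fin fineK ?gen_inverse_fin_num//.
  by move/le_cdf_gen_inverse; rewrite -lee_fin fineK.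
rewrite -(fineK Ffin) -(ui_uniform_lt F01); apply: U01;
  [exact: measurable_ui_lt|exact: measurable_quantile_fun_le|].
move=> u u01 /=; rewrite -lte_fin fineK// => /gen_inverse_le Qu.
by rewrite -lee_fin fineK// gen_inverse_fin_num.
Qed.

End quantile_transform.

(** * Tail averages of a nondecreasing function *)

Section tail_mean.
Variable R : realType.
Local Notation lambda := (@lebesgue_measure R).
Implicit Types f : R -> R.

Definition tail_mean f (a : R) : R :=
  (1 - a)^-1 * \int[lambda]_(t in `[a, 1]) f t.

Variable f : R -> R.
Hypothesis intf : lambda.-integrable `[0, 1] (EFin \o f).
Hypothesis ndf : forall s t, 0 < s -> s <= t -> t < 1 -> f s <= f t.

Let integrable_sub (i : interval R) : [set` i] `<=` `[0, 1] ->
  lambda.-integrable [set` i] (EFin \o f).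
Proof. by move=> i01; exact: integrableS intf. Qed.

Let tail_integralE a : 0 <= a <= 1 -> \int[lambda]_(t in `[a, 1]) f t =
  parameterized_integral lambda 0 1 f - parameterized_integral lambda 0 a f.
Proof.
case/andP => a0 a1; rewrite Rintegral_itvB ?bnd_simp//.
rewrite -Rintegral_itv_obnd_cbnd//; apply: integrable_sub => t /=.
by rewrite !in_itv /= => /andP[at_ ->]; rewrite (le_trans a0 (ltW at_)).
Qed.

Let tail_integral_split a b : 0 <= a -> a <= b -> b < 1 ->
  \int[lambda]_(t in `[a, 1]) f t =
  \int[lambda]_(t in `]a, b[) f t + \int[lambda]_(t in `[b, 1]) f t.
Proof.
move=> a0 ab b1.
have ia1 : lambda.-integrable `[a, 1] (EFin \o f).
  apply: integrable_sub => t /=; rewrite !in_itv /= => /andP[at_ ->].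
  by rewrite (le_trans a0 at_).
have iab : lambda.-integrable `]a, b[ (EFin \o f).
  apply: integrable_sub => t /=; rewrite !in_itv /= => /andP[at_ tb].
  by rewrite (le_trans a0 (ltW at_)) (ltW (lt_trans tb b1)).
have ib1 : lambda.-integrable `]b, 1] (EFin \o f).
  apply: integrable_sub => t /=; rewrite !in_itv /= => /andP[bt ->].
  by rewrite (le_trans a0 (le_trans ab (ltW bt))).
have := @Rintegral_itvB _ f (BLeft a) (BRight 1) b ia1.
rewrite !bnd_simp => /(_ ab (ltW b1)) /eqP; rewrite subr_eq => /eqP ->.
rewrite addrC Rintegral_itv_obnd_cbnd//; congr (_ + _).
rewrite -Rintegral_itv_obnd_cbnd; last first.
  apply: integrable_sub => t /=; rewrite !in_itv /= => /andP[at_ tb].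
  by rewrite (le_trans a0 (ltW at_)) (le_trans tb (ltW b1)).
by rewrite -Rintegral_itv_bndo_bndc.
Qed.

Lemma le_tail_mean a : 0 < a < 1 -> f a <= tail_mean f a.
Proof.
case/andP => a0 a1; rewrite /tail_mean ler_pdivlMl ?subr_gt0//.
(* The endpoint 1 is dropped because [f] is known to be monotone only inside []0, 1[]. *)
have -> : (1 - a) * f a = \int[lambda]_(t in `]a, 1[) cst (f a) t.
  rewrite Rintegral_cst//= lebesgue_measure_itv /= lte_fin a1 -EFinB /=.
  by rewrite mulrC.
have ia1 : lambda.-integrable `]a, 1[ (EFin \o f).
  apply: integrable_sub => t /=; rewrite !in_itv /= => /andP[at_ /ltW ->].
  by rewrite (le_trans (ltW a0) (ltW at_)).
have ia1' : lambda.-integrable `]a, 1] (EFin \o f).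
  apply: integrable_sub => t /=; rewrite !in_itv /= => /andP[at_ ->].
  by rewrite (le_trans (ltW a0) (ltW at_)).
rewrite -Rintegral_itv_obnd_cbnd// -Rintegral_itv_bndo_bndc//.
apply: le_Rintegral => //.
  apply: measurable_bounded_integrable => //; last exact: bounded_cst.
  by rewrite /= lebesgue_measure_itv /= lte_fin a1 -EFinB ltry.
by move=> t /=; rewrite in_itv /= => /andP[at_ t1]; rewrite ndf// ltW.
Qed.

(** The tail from [a] averages the tail from [b] with the piece over []a, b[], where [f] is at most
    [f b], hence at most the mean of the tail from [b]. *)
Lemma tail_mean_nd a b : 0 <= a -> a <= b -> b < 1 ->
  tail_mean f a <= tail_mean f b.
Proof.
move=> a0; rewrite le_eqVlt => /predU1P[-> //|ab] b1.
have b0 : 0 < b by exact: le_lt_trans ab.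
rewrite [leLHS]/tail_mean ler_pdivrMl ?subr_gt0 ?(lt_trans ab)//.
rewrite (tail_integral_split a0 (ltW ab) b1).
have -> : \int[lambda]_(t in `[b, 1]) f t = (1 - b) * tail_mean f b.
  by rewrite /tail_mean mulrA divff ?mul1r// subr_eq0 gt_eqF.
have -> : (1 - a) * tail_mean f b =
    (b - a) * tail_mean f b + (1 - b) * tail_mean f b.
  by rewrite -mulrDl; congr (_ * _); ring.
rewrite lerD2r (@le_trans _ _ ((b - a) * f b))//; last first.
  by rewrite ler_pM2l ?subr_gt0// le_tail_mean// b0.
have -> : (b - a) * f b = \int[lambda]_(t in `]a, b[) cst (f b) t.
  rewrite Rintegral_cst//= lebesgue_measure_itv /= lte_fin ab -EFinB /=.
  by rewrite mulrC.
apply: le_Rintegral => //.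
- apply: integrable_sub => t /=; rewrite !in_itv /= => /andP[at_ tb].
  by rewrite (le_trans a0 (ltW at_)) (ltW (lt_trans tb b1)).
- apply: measurable_bounded_integrable => //; last exact: bounded_cst.
  by rewrite /= lebesgue_measure_itv /= lte_fin ab -EFinB ltry.
move=> t /=; rewrite in_itv /= => /andP[at_ tb].
by rewrite ndf ?(le_lt_trans a0)// ltW.
Qed.

(** Cutting at [c < 1] keeps the denominator away from 0; the numerator is continuous as an integral
    with a moving bound. *)
Lemma continuous_tail_mean (c : R) : 0 <= c < 1 ->
  continuous (fun u : unit_interval R => tail_mean f (Num.min (ui_val u) c)).
Proof.
case/andP => c0 c1.
(* The cut point as an element of [0, 1], so that the parameterized integral, continuous on that
   space, can be composed with it. *)
pose m (u : unit_interval R) := ui_clamp (Num.min (ui_val u) c).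
have m_in u : 0 <= Num.min (ui_val u) c <= 1.
  have /andP[u0 u1] := ui_val_itv u.
  by rewrite le_min u0 c0/= ge_min u1.
have mE u : ui_val (m u) = Num.min (ui_val u) c by rewrite ui_clampE clamp01_id.
have cmin : continuous (fun u : unit_interval R => Num.min (ui_val u) c).
  move=> u; have := @continuous_min _ _ (@ui_val R) (cst c) u.
  by apply; [exact: continuous_ui_val|exact: cst_continuous].
have cm : continuous m.
  apply: (@continuous_comp_initial _ _ _ (@set_val R `[0, 1]%classic)).
  by rewrite (_ : _ \o _ = fun u => Num.min (ui_val u) c)//; apply/funext.
have cJ : continuous (fun u : unit_interval R =>
    parameterized_integral lambda 0 (ui_val u) f).
  have /subspace_sigL_continuousP :=
    @parameterized_integral_continuous R 0 1 f ler01 intf.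
  exact.
pose s (u : unit_interval R) : R := 1 - Num.min (ui_val u) c.
pose t (u : unit_interval R) : R := parameterized_integral lambda 0 1 f -
  parameterized_integral lambda 0 (ui_val (m u)) f.
rewrite (_ : (fun _ => _) = (fun u => (s u)^-1) \* t); last first.
  apply/funext => u.
  by rewrite /GRing.mul_fun /s /t mE /tail_mean tail_integralE.
have cs : continuous s.
  by move=> u; exact: (cvgB (cvg_cst (1 : R)) (cmin u)).
have ct : continuous t.
  have cJm := fun u => continuous_comp (cm u) (cJ (m u)).
  move=> u.
  exact: (cvgB (cvg_cst (parameterized_integral lambda 0 1 f)) (cJm u)).
move=> u.
have s0 : s u != 0.
  by rewrite subr_eq0 gt_eqF// (le_lt_trans _ c1)// ge_min lexx orbT.
exact: (continuousM (continuousV s0 (cs u)) (ct u)).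
Qed.

End tail_mean.

(** * Comparison and monotone limits of integrals *)

Section monotone_integrals.
Context d (T : measurableType d) (R : realType).
Variable mu : {measure set T -> \bar R}.
Local Open Scope ereal_scope.

(** Positive and negative parts are compared separately, so neither function has to be
    integrable. *)
Lemma measurable_le_integral (D : set T) (f g : T -> \bar R) :
  measurable D -> measurable_fun D f -> measurable_fun D g ->
  (forall x, D x -> f x <= g x) ->
  \int[mu]_(x in D) f x <= \int[mu]_(x in D) g x.
Proof.
move=> mD mf mg fg; rewrite integralE [leRHS]integralE leeB//.
- apply: ge0_le_integral => //; try exact: measurable_funepos.
  by move=> x /mem_set; apply: funepos_le => y /set_mem; exact: fg.
- apply: ge0_le_integral => //; try exact: measurable_funeneg.
  by move=> x /mem_set; apply: funeneg_le => y /set_mem; exact: fg.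
Qed.

(** The [h n] may be negative: monotone convergence is applied to the nonnegative [h n - h 0], and
    the finite integral of [h 0] is added back. *)
Lemma le_integral_nondecreasing_lim (D : set T) (h : nat -> T -> R) (F : T -> R)
    (c : R) :
  measurable D -> (forall n, mu.-integrable D (EFin \o h n)) ->
  (forall x, D x -> nondecreasing_seq (h ^~ x)) ->
  (forall x, D x -> h ^~ x @ \oo --> F x) ->
  (forall n, \int[mu]_(x in D) (h n x)%:E <= c%:E) ->
  \int[mu]_(x in D) (F x)%:E <= c%:E.
Proof.
move=> mD hint hnd hF hc.
have h0F x : D x -> (h 0%N x <= F x)%R.
  move=> Dx; have cvgh : cvgn (h ^~ x) by apply/cvg_ex; exists (F x); exact: hF.
  have := nondecreasing_cvgn_le (hnd x Dx) cvgh 0%N.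
  by rewrite (cvg_lim _ (hF x Dx)).
have mh n : measurable_fun D (h n).
  by apply/measurable_EFinP; exact: measurable_int (hint n).
have mF : measurable_fun D F by apply: (measurable_fun_cvg mh).
pose c0 := \int[mu]_(x in D) (h 0%N x)%:E.
have c0fin : c0 \is a fin_num by exact: (integrable_fin_num mD (hint 0%N)).
have diffE n : \int[mu]_(x in D) (h n x - h 0%N x)%:E <= c%:E - c0.
  under eq_integral do rewrite EFinB.
  by rewrite integralB_EFin// leeB.
have cvgD : \int[mu]_(x in D) (h n x - h 0%N x)%:E @[n --> \oo] -->
    \int[mu]_(x in D) (F x - h 0%N x)%:E.
  have -> : \int[mu]_(x in D) (F x - h 0%N x)%:E =
      \int[mu]_(x in D) (fun x => limn (fun n => (h n x - h 0%N x)%:E)) x.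
    apply: eq_integral => x /set_mem Dx; apply/esym/cvg_lim => //.
    by apply: cvg_EFin; [near=> n|apply: cvgB; [exact: hF|exact: cvg_cst]].
  apply: cvg_monotone_convergence => //.
  - by move=> n; apply/measurable_EFinP; exact: measurable_funB.
  - by move=> n x Dx; rewrite lee_fin subr_ge0 hnd.
  - by move=> x Dx m n mn; rewrite lee_fin lerD2r hnd.
have Fc : \int[mu]_(x in D) (F x - h 0%N x)%:E <= c%:E - c0.
  rewrite -(cvg_lim _ cvgD)//; apply: lime_le; last exact: nearW.
  by apply/cvg_ex; eexists; exact: cvgD.
have intFh : mu.-integrable D (EFin \o (fun x => F x - h 0%N x)%R).
  apply/integrableP; split.
    by apply/measurable_EFinP; exact: measurable_funB.
  rewrite (eq_integral (fun x => (F x - h 0%N x)%:E)); last first.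
    by move=> x /set_mem Dx; rewrite /= ger0_norm// subr_ge0 h0F.
  by rewrite (le_lt_trans Fc)// ltey_eq fin_numB c0fin.
have -> : \int[mu]_(x in D) (F x)%:E =
    \int[mu]_(x in D) (F x - h 0%N x)%:E + c0.
  rewrite /c0 -integralD_EFin//; apply: eq_integral => x _ /=.
  by rewrite -EFinD subrK.
by rewrite -leeBrDr.
Unshelve. all: by end_near. Qed.

End monotone_integrals.

(** * Integrals on [0, 1] as Lebesgue integrals *)

Section ui_uniform_integral.
Variable R : realType.
Local Open Scope ereal_scope.

Lemma ge0_integral_ui_uniform (f : R -> \bar R) :
  measurable_fun setT f -> (forall t, 0 <= f t) ->
  \int[ui_uniform R]_u f (ui_val u) =
  \int[lebesgue_measure]_(t in `[0%R, 1%R]) f t.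
Proof.
move=> mf f0.
pose v : unit_interval R -> measurableTypeR R := @ui_val R.
have mv : measurable_fun setT v := @measurable_ui_val R.
pose X : {mfun unit_interval R >-> measurableTypeR R} :=
  HB.pack v (isMeasurableFun.Build _ _ _ _ v mv).
have XE : \int[distribution (ui_uniform R) X]_(t in `[0%R, 1%R]) f t =
    \int[ui_uniform R]_u f (ui_val u).
  rewrite ge0_integral_pushforward//=; last exact: measurable_funTS.
  congr (integral _ _ _); rewrite -subTset => u _ /=.
  by rewrite in_itv /= ui_val_itv.
rewrite -XE.
apply: (@eq_measure_integral _ (measurableTypeR R) R `[0%R, 1%R]%classic
  lebesgue_measure (distribution (ui_uniform R) X) f).
move=> A mA A01; rewrite /distribution /pushforward /ui_uniform /=.
congr lebesgue_measure.
apply/seteqP; split => [_ [u Au <-] //|t At].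
have t01 : (0 <= t <= 1)%R by have := A01 _ At; rewrite /= in_itv.
exists (ui_clamp t); last exact: clamp01_id.
by change (A (clamp01 t)); rewrite clamp01_id.
Qed.

End ui_uniform_integral.

(** * Average value at risk and its continuous truncations *)

Section AVaR_facts.
Context d (T : measurableType d) (R : realType) (P : probability T R).
Variables (p : R) (p1 : (1 <= p%:E)%E) (Z : LfunType P p1).
Local Notation I := (unit_interval R).
Local Notation lambda := (@lebesgue_measure R).

Definition real_quantile (t : R) : R :=
  fine (gen_inverse (cdf (Z : {RV P >-> R})) t).

Lemma LfunType_integrable : P.-integrable setT (EFin \o Z).
Proof.
apply/Lfun1_integrable; apply: (Lfun_subset (lexx 1%E) p1 _ p1).
  exact: fin_num_measure.
exact: LfunP.
Qed.

Lemma real_quantile_nd s t : 0 < s -> s <= t -> t < 1 ->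
  real_quantile s <= real_quantile t.
Proof.
move=> s0 st t1; apply: fine_le; last exact: gen_inverse_nd.
- by apply: gen_inverse_fin_num; rewrite s0 (le_lt_trans st).
- by apply: gen_inverse_fin_num; rewrite t1 (lt_le_trans s0).
Qed.

Lemma measurable_real_quantile : measurable_fun setT real_quantile.
Proof. exact: (measurableT_comp _ (measurable_gen_inverse _)). Qed.

(** Under the uniform measure the quantile has the law of [Z], which is integrable since L_p is
    contained in L_1 on a probability space. *)
Lemma integrable_real_quantile :
  lambda.-integrable `[0, 1] (EFin \o real_quantile).
Proof.
apply/integrableP; split.
  apply/measurable_EFinP; apply: measurable_funTS.
  exact: measurable_real_quantile.
rewrite -(@ge0_integral_ui_uniform _
  (fun t => `|(real_quantile t)%:E|%E))//; last first.
  apply: measurableT_comp => //; apply/measurable_EFinP.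
  exact: measurable_real_quantile.
pose X : {RV P >-> R} := Z.
have mabs : measurable_fun setT (fun y : R => `|y%:E|%E).
  by apply: measurableT_comp => //; exact: measurable_EFin.
have := @ge0_integral_distribution _ _ _ _ _ (ui_uniform R) (quantile_fun X)
  (fun y => `|y%:E|%E) mabs (fun y => abse_ge0 _).
rewrite /comp => <-.
rewrite (@eq_measure_integral _ R R setT (distribution P X)); last first.
  by move=> A mA _; exact: distribution_quantile_fun.
rewrite ge0_integral_distribution//.
by have /integrableP[] := LfunType_integrable.
Qed.

Lemma AVaRE a : 0 <= a < 1 -> AVaR a Z = (tail_mean real_quantile a)%:E.
Proof.
case/andP => a0 a1; rewrite /AVaR /tail_mean EFinM; congr (_ * _)%E.
have mQ := measurable_gen_inverse (Z : {RV P >-> R}).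
have ia1 : lambda.-integrable `[a, 1] (EFin \o real_quantile).
  apply: integrableS integrable_real_quantile => // t /=.
  by rewrite !in_itv /= => /andP[at_ ->]; rewrite (le_trans a0 at_).
rewrite /Rintegral fineK; last exact: integrable_fin_num.
(* Both integrals are moved to the open interval: at 0 and 1 the quantile may be infinite and differ
   from [real_quantile]. *)
rewrite integral_itv_bndoo; last exact: measurable_funTS.
rewrite [RHS]integral_itv_bndoo; last first.
  apply/measurable_EFinP; apply: measurable_funTS.
  exact: measurable_real_quantile.
apply: eq_integral => t /set_mem; rewrite /= in_itv /= => /andP[at_ t1].
by rewrite fineK// gen_inverse_fin_num// t1 (le_lt_trans a0).
Qed.

Lemma AVaR1 : AVaR 1 Z = 0%E.
Proof. by rewrite /AVaR set_itv1 integral_set1 mule0. Qed.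

(* The truncation [a <= 1 - 1/(n+1)] makes the average value at risk a
   continuous function on the whole of [0, 1]. *)
Definition AVaR_trunc (n : nat) (u : I) : R :=
  tail_mean real_quantile (Num.min (ui_val u) (1 - n.+1%:R^-1)).

Let cut01 n : 0 <= (1 - n.+1%:R^-1 : R) < 1.
Proof. by rewrite subr_ge0 invf_le1// ler1n/= ltrBlDr ltrDl invr_gt0. Qed.

Lemma continuous_AVaR_trunc n : continuous (AVaR_trunc n).
Proof.
by apply: continuous_tail_mean; [exact: integrable_real_quantile|exact: cut01].
Qed.

Let min_cut n (u : I) : 0 <= Num.min (ui_val u) (1 - n.+1%:R^-1) < 1.
Proof.
have /andP[c0 c1] := cut01 n; have /andP[u0 _] := ui_val_itv u.
by rewrite le_min u0 c0/= (le_lt_trans _ c1)// ge_min lexx orbT.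
Qed.

Lemma AVaR_trunc_nd n (u v : I) : ui_val u <= ui_val v ->
  AVaR_trunc n u <= AVaR_trunc n v.
Proof.
move=> uv; apply: tail_mean_nd.
- exact: integrable_real_quantile.
- exact: real_quantile_nd.
- by have /andP[] := min_cut n u.
- by rewrite le_min !ge_min uv lexx orbT.
- by have /andP[] := min_cut n v.
Qed.

Lemma AVaR_trunc_ndn (u : I) : nondecreasing_seq (AVaR_trunc ^~ u).
Proof.
move=> m n mn; apply: tail_mean_nd.
- exact: integrable_real_quantile.
- exact: real_quantile_nd.
- by have /andP[] := min_cut m u.
- rewrite le_min !ge_min lexx /= lerD2l lerN2 lef_pV2 ?posrE//.
  by rewrite ler_nat ltnS mn orbT.
- by have /andP[] := min_cut n u.
Qed.

(** The sequence is eventually constant: the cut has no effect once [1/(n+1) <= 1 - u]. *)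
Lemma cvg_AVaR_trunc (u : I) : ui_val u < 1 ->
  AVaR_trunc ^~ u @ \oo --> fine (AVaR (ui_val u) Z).
Proof.
move=> u1; have /andP[u0 _] := ui_val_itv u.
rewrite AVaRE ?u0//=.
have u1' : 0 < 1 - ui_val u by rewrite subr_gt0.
apply: cvg_near_cst; near=> n; rewrite /AVaR_trunc min_l//.
rewrite lerBrDr addrC -lerBrDr.
by apply: ltW; near: n; exact: (near_infty_natSinv_lt (PosNum u1')).
Unshelve. all: by end_near. Qed.

End AVaR_facts.

(** * Bounded and continuous functions on [0, 1] *)

Lemma bounded_probability_integrable d (T : measurableType d) (R : realType)
    (P : probability T R) (f : T -> R) (C : R) :
  measurable_fun setT f -> (forall x, `|f x| <= C) ->
  P.-integrable setT (EFin \o f).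
Proof.
move=> mf fC; apply: measurable_bounded_integrable => //.
  by rewrite (le_lt_trans (probability_le1 _ _))// ltry.
exists C; split; first exact: num_real.
by move=> D CD x _ /=; rewrite (le_trans (fC x))// ltW.
Qed.

Section continuous_functions_on_unit_interval.
Variable R : realType.
Local Notation I := (unit_interval R).
Implicit Types f : I -> R.

Lemma continuous_ui_clamp : continuous (@ui_clamp R).
Proof.
apply: (@continuous_comp_initial _ _ _ (@set_val R `[0, 1]%classic)).
rewrite (_ : _ \o _ = @clamp01 R)// => x.
have := @continuous_max _ _ (cst 0 : R -> R^o)
  (fun x : R => Num.min x 1 : R^o) x; apply.
  exact: cst_continuous.
have := @continuous_min _ _ (id : R -> R^o) (cst 1) x.
by apply; [exact: cvg_id|exact: cst_continuous].
Qed.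

(** Compactness is taken from the real segment, to which [f] is transported by [ui_clamp]. *)
Lemma continuous_ui_bounded f : continuous f -> exists C, forall u, `|f u| <= C.
Proof.
move=> cf; have cg : continuous (f \o @ui_clamp R).
  by move=> x; apply: continuous_comp; [exact: continuous_ui_clamp|exact: cf].
have : compact ((f \o @ui_clamp R) @` `[0, 1]%classic).
  apply: continuous_compact; last exact: segment_compact.
  exact: continuous_subspaceT.
move/compact_bounded => [C [_ fC]]; exists (C + 1) => u.
apply: (fC (C + 1)); first by rewrite ltrDl.
exists (ui_val u); last by rewrite /= ui_valK.
by rewrite /= in_itv /= ui_val_itv.
Qed.

Lemma measurable_continuous_ui f : continuous f -> measurable_fun setT f.
Proof.
move=> cf.
have -> : f = (f \o @ui_clamp R) \o @ui_val R.
  by apply/funext => u; rewrite /= ui_valK.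
apply: measurableT_comp; last exact: measurable_ui_val.
apply: continuous_measurable_fun => x.
by apply: continuous_comp; [exact: continuous_ui_clamp|exact: cf].
Qed.

Lemma integrable_continuous_ui (mu : probability I R) f :
  continuous f -> mu.-integrable setT (EFin \o f).
Proof.
move=> cf; have [C fC] := continuous_ui_bounded cf.
exact: (bounded_probability_integrable mu (measurable_continuous_ui cf) fC).
Qed.

End continuous_functions_on_unit_interval.

(** * Stochastic dominance through the quantile coupling *)

Section quantile_coupling.
Variable R : realType.
Local Notation I := (unit_interval R).
Local Notation U := (ui_uniform R).
Implicit Types mu nu : probability I R.

(** A random point with law [mu] on the common space [I] with the uniform measure; dominance becomes
    a pointwise inequality there. *)
Definition ui_quantile mu (u : I) : I :=
  ui_clamp (quantile_fun (@ui_val R : {RV mu >-> R}) u).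

Lemma dfunE mu a : dfun mu a = cdf (@ui_val R : {RV mu >-> R}) a.
Proof.
by rewrite /dfun /cdf /distribution /pushforward; congr (mu _);
  apply/seteqP; split => u /=; rewrite in_itv.
Qed.

Lemma measurable_ui_quantile mu : measurable_fun setT (ui_quantile mu).
Proof.
apply: measurableT_comp; first exact: measurable_ui_clamp.
exact: measurable_quantile_fun.
Qed.

HB.instance Definition _ mu :=
  isMeasurableFun.Build _ _ _ _ (ui_quantile mu) (@measurable_ui_quantile mu).

Lemma distribution_ui_quantile mu (A : set I) : measurable A ->
  distribution U (ui_quantile mu) A = mu A.
Proof.
move=> mA; have mB := measurable_ui_clamp measurableT mA.
rewrite setTI in mB.
have := distribution_quantile_fun (@ui_val R : {RV mu >-> R}) mB.
rewrite /distribution /pushforward => e.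
transitivity (mu (@ui_val R @^-1` (@ui_clamp R @^-1` A))); first exact: e.
by congr (mu _); apply/seteqP; split => u /=; rewrite ui_valK.
Qed.

Lemma fsd_refl mu : fsd mu mu. Proof. by move=> a. Qed.

Lemma fsd_trans mu nu xi : fsd mu nu -> fsd nu xi -> fsd mu xi.
Proof. by move=> munu nuxi a; rewrite (le_trans (nuxi a)). Qed.

(** Even [t = 0] is allowed: the distribution function vanishes at -1 and equals 1 at 1, which
    bounds the quantile on both sides. *)
Let gen_inverse_ui_fin mu (t : R) : 0 <= t < 1 ->
  gen_inverse (cdf (@ui_val R : {RV mu >-> R})) t \is a fin_num.
Proof.
case/andP => t0 t1; rewrite fin_numElt; apply/andP; split.
  have : ((-1)%:E <= gen_inverse (cdf (@ui_val R : {RV mu >-> R})) t)%E.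
    apply: gen_inverse_ge; rewrite -dfunE /dfun (_ : [set _ | _] = set0).
      by rewrite measure0 lee_fin.
    rewrite -subset0 => u /=; have /andP[u0 _] := ui_val_itv u.
    by move=> u1; have := le_trans u0 u1; rewrite ler0N1.
  exact: lt_le_trans (ltNyr _).
have : (gen_inverse (cdf (@ui_val R : {RV mu >-> R})) t <= 1%:E)%E.
  apply: gen_inverse_le; rewrite -dfunE /dfun (_ : [set _ | _] = setT).
    by rewrite probability_setT lte_fin.
  by rewrite -subTset => u _ /=; have /andP[] := ui_val_itv u.
by move=> Q1; exact: le_lt_trans Q1 (ltry _).
Qed.

Let gen_inverse_ui1 mu :
  gen_inverse (cdf (@ui_val R : {RV mu >-> R})) 1 = +oo%E.
Proof.
by apply/eqyP => r _; apply: gen_inverse_ge; exact: cdf_le1.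
Qed.

(* No almost everywhere restriction is needed: at [u = 1] both quantiles have
   the junk value [fine +oo = 0]. *)
Lemma fsd_ui_quantile mu nu u : fsd mu nu ->
  ui_val (ui_quantile mu u) <= ui_val (ui_quantile nu u).
Proof.
move=> munu; rewrite !ui_clampE; apply: clamp01_le; rewrite /quantile_fun.
have /andP[u0] := ui_val_itv u; rewrite le_eqVlt => /predU1P[->|u1].
  by rewrite !gen_inverse_ui1.
apply: fine_le; try by apply: gen_inverse_ui_fin; rewrite u0.
apply: le_ereal_sup; apply: image_subset => t /=; rewrite -!dfunE.
exact: le_trans (munu t).
Qed.

Lemma integral_ui_quantile mu (f : I -> \bar R) :
  measurable_fun setT f -> mu.-integrable setT f ->
  (\int[mu]_u f u = \int[U]_u f (ui_quantile mu u))%E.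
Proof.
move=> mf intf.
have E (g : I -> \bar R) :
    (\int[distribution U (ui_quantile mu)]_u g u = \int[mu]_u g u)%E.
  by apply: eq_measure_integral => A mA _; exact: distribution_ui_quantile.
rewrite -E integral_distribution//.
apply/integrableP; split; first exact: (measurableT_comp mf).
rewrite -(@ge0_integral_distribution _ _ _ _ _ U (ui_quantile mu)
  (fun u => `|f u|%E))//.
  by rewrite E; case/integrableP : intf.
exact: measurableT_comp.
Qed.

Lemma Rintegral_ui_quantile mu (f : I -> R) : continuous f ->
  \int[mu]_u f u = \int[U]_u f (ui_quantile mu u).
Proof.
move=> cf; rewrite /Rintegral (@integral_ui_quantile mu (EFin \o f))//.
  by apply/measurable_EFinP; exact: measurable_continuous_ui.
exact: integrable_continuous_ui.
Qed.

Lemma integrable_comp_ui_quantile mu (f : I -> R) : continuous f ->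
  U.-integrable setT (EFin \o (fun u => f (ui_quantile mu u))).
Proof.
move=> cf; have [C fC] := continuous_ui_bounded cf.
apply: (@bounded_probability_integrable _ _ _ U _ C) => //.
apply: (measurableT_comp (measurable_continuous_ui cf)).
exact: measurable_ui_quantile.
Qed.

Lemma fsd_Rintegral_le mu nu (f : I -> R) : continuous f ->
  (forall u v, ui_val u <= ui_val v -> f u <= f v) ->
  fsd mu nu -> \int[mu]_u f u <= \int[nu]_u f u.
Proof.
move=> cf ndf munu.
rewrite (Rintegral_ui_quantile mu cf) (Rintegral_ui_quantile nu cf).
apply: le_Rintegral => //; try exact: integrable_comp_ui_quantile.
by move=> u _; apply: ndf; exact: fsd_ui_quantile.
Qed.

Definition ui_mean mu : R := \int[mu]_u ui_val u.

(** The difference of the two quantile functions is nonnegative with integral 0, so they agree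
    almost everywhere and have the same law. *)
Lemma fsd_ui_mean_measure_eq mu nu : fsd mu nu -> ui_mean nu <= ui_mean mu ->
  measure_eq mu nu.
Proof.
move=> munu; rewrite /ui_mean (Rintegral_ui_quantile mu (@continuous_ui_val R))
  (Rintegral_ui_quantile nu (@continuous_ui_val R)) => numu A mA.
have imu := integrable_comp_ui_quantile mu (@continuous_ui_val R).
have inu := integrable_comp_ui_quantile nu (@continuous_ui_val R).
pose delta u := ui_val (ui_quantile nu u) - ui_val (ui_quantile mu u).
have int0 : (\int[U]_u `|(delta u)%:E| = 0)%E.
  rewrite (eq_integral (fun u => (delta u)%:E)); last first.
    by move=> u _; rewrite /= ger0_norm// subr_ge0 fsd_ui_quantile.
  have dint : U.-integrable setT (EFin \o delta).
    exact: (integrableB measurableT inu imu).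
  rewrite -[LHS]fineK; last exact: integrable_fin_num.
  rewrite -[fine _]/(\int[U]_u delta u) RintegralB//; apply/eqP.
  rewrite eqe subr_eq0 eq_le numu /=.
  by apply: le_Rintegral => // u _; exact: fsd_ui_quantile.
have mdiff : measurable_fun setT (fun u => (delta u)%:E).
  by apply/measurable_EFinP; apply: measurable_funB;
    apply: (measurableT_comp (@measurable_ui_val R));
    exact: measurable_ui_quantile.
have /(ae_eq_integral_abs U measurableT mdiff) diff0 := int0.
rewrite -[LHS](distribution_ui_quantile mu mA).
rewrite -[RHS](distribution_ui_quantile nu mA).
have m1 : measurable_fun setT (fun u : I => (\1_A u)%:E : \bar R).
  by apply/measurable_EFinP; exact: measurable_indic.
have indE xi : distribution U (ui_quantile xi) A =
    (\int[U]_u (\1_A (ui_quantile xi u))%:E)%E.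
  have g0 (u : I) : (0 <= (\1_A u)%:E :> \bar R)%E by [].
  have <- := @ge0_integral_distribution _ _ _ _ _ U (ui_quantile xi) _ m1 g0.
  by rewrite integral_indic// setIT.
rewrite !indE; apply: ae_eq_integral => //.
- by apply: (measurableT_comp m1); exact: measurable_ui_quantile.
- by apply: (measurableT_comp m1); exact: measurable_ui_quantile.
apply: filterS diff0 => u /(_ Logic.I) [] /eqP; rewrite subr_eq0 => /eqP e _.
by congr (\1_A _)%:E; apply: ui_val_inj; rewrite e.
Qed.

End quantile_coupling.

(** * Limits of increasing sequences of measures *)

Section increasing_limit.
Variable R : realType.
Local Notation I := (unit_interval R).
Local Notation U := (ui_uniform R).
Variable mu_ : nat -> probability I R.
Hypothesis fsd_mu_ : forall n, fsd (mu_ n) (mu_ n.+1).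

Let q n u : R := ui_val (ui_quantile (mu_ n) u).

Let q_nd u : nondecreasing_seq (q ^~ u).
Proof. by apply/nondecreasing_seqP => n; exact: fsd_ui_quantile. Qed.

Let cvg_q u : cvgn (q ^~ u).
Proof.
apply: nondecreasing_is_cvgn => //; exists 1 => _ [n _ <-].
by have /andP[] := ui_val_itv (ui_quantile (mu_ n) u).
Qed.

(** The limit is taken in R and already lies in [0, 1]; the clamp only restores the type. *)
Definition limit_quantile (u : I) : I := ui_clamp (limn (q ^~ u)).

Let cvg_ui_quantile u : ui_quantile (mu_ n) u @[n --> \oo] --> limit_quantile u.
Proof.
have -> : (fun n => ui_quantile (mu_ n) u) = @ui_clamp R \o (q ^~ u).
  by apply/funext => n; rewrite /= ui_valK.
apply: (@cvg_comp _ _ _ (q ^~ u) (@ui_clamp R) _ (nbhs (limn (q ^~ u)))).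
  exact: cvg_q.
exact: continuous_ui_clamp.
Qed.

Let ui_val_limit_quantile u : ui_val (limit_quantile u) = limn (q ^~ u).
Proof.
rewrite ui_clampE clamp01_id//; apply/andP; split.
  apply: limr_ge => //; apply: nearW => n.
  by have /andP[] := ui_val_itv (ui_quantile (mu_ n) u).
apply: limr_le => //; apply: nearW => n.
by have /andP[] := ui_val_itv (ui_quantile (mu_ n) u).
Qed.

Lemma measurable_limit_quantile : measurable_fun setT limit_quantile.
Proof.
apply: (measurableT_comp (@measurable_ui_clamp R)).
apply: (@measurable_fun_cvg _ _ _ setT q) => [n|u _]; last exact: cvg_q.
apply: (measurableT_comp (@measurable_ui_val R)); exact: measurable_ui_quantile.
Qed.

HB.instance Definition _ :=
  isMeasurableFun.Build _ _ _ _ limit_quantile measurable_limit_quantile.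

Definition fsd_limit : probability I R := distribution U limit_quantile.

Lemma fsd_fsd_limit n : fsd (mu_ n) fsd_limit.
Proof.
move=> a; rewrite /dfun -(distribution_ui_quantile (mu_ n))//; last first.
  exact: measurable_ui_le.
rewrite /fsd_limit /distribution /pushforward /=.
apply: le_measure; rewrite ?inE.
- rewrite -[X in measurable X]setTI; apply: measurable_limit_quantile => //.
  exact: measurable_ui_le.
- rewrite -[X in measurable X]setTI; apply: measurable_ui_quantile => //.
  exact: measurable_ui_le.
- move=> u; rewrite /preimage /mkset; apply: le_trans.
  rewrite ui_val_limit_quantile.
  exact: (nondecreasing_cvgn_le (q_nd u) (@cvg_q u) n).
Qed.

(** After the coupling this is dominated convergence: the quantile functions converge pointwise and
    [f] is bounded. *)
Lemma cvg_integral_fsd_limit (f : I -> R) : continuous f ->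
  \int[mu_ n]_u f u @[n --> \oo] --> \int[fsd_limit]_u f u.
Proof.
move=> cf; have mf := measurable_continuous_ui cf.
have [C fC] := continuous_ui_bounded cf.
have mlim : measurable_fun setT (f \o limit_quantile).
  by apply: (measurableT_comp mf); exact: measurable_limit_quantile.
have ilim : U.-integrable setT (EFin \o (f \o limit_quantile)).
  by apply: (@bounded_probability_integrable _ _ _ U _ C) => // u; exact: fC.
have -> : \int[fsd_limit]_u f u = \int[U]_u f (limit_quantile u).
  rewrite /Rintegral /fsd_limit.
  rewrite (@integral_distribution _ _ _ _ _ U _ (EFin \o f))//.
  exact/measurable_EFinP.
have -> : (fun n => \int[mu_ n]_u f u) =
    (fun n => \int[U]_u f (ui_quantile (mu_ n) u)).
  by apply/funext => n; rewrite Rintegral_ui_quantile.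
apply: fine_cvg; rewrite fineK; last first.
  exact: integrable_fin_num.
have [] := @dominated_convergence _ _ _ U setT measurableT
  (fun n u => (f (ui_quantile (mu_ n) u))%:E)
  (fun u => (f (limit_quantile u))%:E)
  (cst C%:E) => //.
- move=> n; apply/measurable_EFinP; apply: (measurableT_comp mf).
  exact: measurable_ui_quantile.
- exact/measurable_EFinP.
- apply: aeW => u _; apply: cvg_EFin; first exact: nearW.
  by apply: continuous_cvg; [exact: cf|exact: cvg_ui_quantile].
- by apply: finite_measure_integrable_cst.
- by apply: aeW => u n _; rewrite /= lee_fin.
Qed.

End increasing_limit.

(** * Closure in the weak topology *)

Section weak_closure.
Variable R : realType.
Local Notation I := (unit_interval R).
Implicit Types (M : set (probability I R)) (mu : probability I R).

Lemma closure_fsd_limit M (mu_ : nat -> probability I R)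
    (fsd_mu_ : forall n, fsd (mu_ n) (mu_ n.+1)) :
  (forall n, M (mu_ n)) ->
  closure (M : set (weak_probability R)) (fsd_limit fsd_mu_).
Proof.
move=> Mmu B nB.
have [W [[V oV VO] Omu] OB] : exists2 W : set (weak_probability R),
    open_nbhs (fsd_limit fsd_mu_ : weak_probability R) W & W `<=` B.
  by move: nB; rewrite nbhsE.
have Vmu : V (integrals_of_continuous (fsd_limit fsd_mu_)).
  by move: Omu; rewrite -VO.
have cvg_mu : {ptws, ((fun n => @integrals_of_continuous R (mu_ n)) @ \oo) -->
    integrals_of_continuous (fsd_limit fsd_mu_)}.
  (* The pointwise topology is the supremum of those induced by the evaluations, so each test
     function can be treated alone. *)
  apply/cvg_sup => f A [A'] [[W' oW' <-] W'f] A'A.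
  have cvgf : \int[mu_ n]_u f u @[n --> \oo] --> \int[fsd_limit fsd_mu_]_u f u.
    by apply: cvg_integral_fsd_limit; exact: cts_fun.
  by apply: filterS A'A _; apply: cvgf; exact: open_nbhs_nbhs.
have : \forall n \near \oo, V (integrals_of_continuous (mu_ n)).
  by apply: cvg_mu; exact: open_nbhs_nbhs.
case/filter_ex => n Vn; exists (mu_ n); split; first exact: Mmu.
by apply: OB; rewrite -VO.
Qed.

Lemma closure_Rintegral_le M (f : I -> R) (c : R) : continuous f ->
  (forall mu, M mu -> \int[mu]_u f u <= c) ->
  forall mu, closure (M : set (weak_probability R)) mu -> \int[mu]_u f u <= c.
Proof.
move=> cf Mc mu clmu; rewrite leNgt; apply/negP => cmu.
(* As an index of the product space, [f] makes integration a coordinate projection, hence weakly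
   continuous. *)
pose F : continuousType I R := HB.pack f (isContinuous.Build _ _ f cf).
have ev : continuous
    (fun nu : weak_probability R => integrals_of_continuous nu F).
  move=> nu.
  have ci := @initial_continuous _ _ (@integrals_of_continuous R) nu.
  have cp := @proj_continuous _
    (fun _ : continuousType I R => R : topologicalType) F
    (integrals_of_continuous nu).
  exact: (continuous_comp ci cp).
have [nu [Mnu /=]] : (M : set (weak_probability R)) `&`
    [set nu | c < integrals_of_continuous nu F] !=set0.
  have cnbhs : nbhs (integrals_of_continuous mu F) [set x | c < x].
    by apply: open_nbhs_nbhs; split => //; exact: open_gt.
  by apply: clmu; exact: (@ev mu _ cnbhs).
by rewrite ltNge Mc.
Qed.

End weak_closure.

(** * An essentially unbounded function in L_p *)

Section unbounded_Lp_function.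
Variable R : realType.
Local Notation I := (unit_interval R).
Local Notation U := (ui_uniform R).

(** Excluding 0 puts every point in only finitely many [A k], so the partial sums [h] are eventually
    constant everywhere. *)
Let A (k : nat) : set I := [set u | 0 < ui_val u < 2^-1 ^+ k].

Let mA k : measurable (A k).
Proof.
rewrite -[X in measurable X]setTI
  (_ : A k = @ui_val R @^-1` `]0, 2^-1 ^+ k[%classic).
  exact: measurable_ui_val.
by apply/seteqP; split => u /=; rewrite in_itv.
Qed.

Let h (n : nat) (u : I) : R := \sum_(0 <= k < n) \1_(A k) u.

Let h_nd u : nondecreasing_seq (h ^~ u).
Proof.
apply/nondecreasing_seqP => n; rewrite /h big_nat_recr//= lerDl.
by rewrite indicE.
Qed.

Let h_stat u : exists N, forall n, (N <= n)%N -> h n u = h N u.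
Proof.
have [u0|u0] := ltP 0 (ui_val u).
  have /filter_ex[N HN] := near_infty_natSinv_expn_lt (PosNum u0).
  exists N => n Nn; rewrite /h (big_cat_nat (leq0n N) Nn)/= [X in _ + X]big_nat.
  rewrite [X in _ + X]big1 ?addr0// => k /andP[Nk _].
  rewrite indicE memNset// /A /= u0 /= => uk.
  have := lt_trans HN uk; rewrite /= div1r -exprVn ltNge.
  by rewrite ler_wiXn2l// ?invr_ge0// invf_le1// ler1n.
have h0 m : h m u = 0.
  by rewrite /h big1// => k _; rewrite indicE memNset// /A /= ltNge u0.
by exists 0%N => n _; rewrite !h0.
Qed.

(* [Y] has mean at most [2] and exceeds [K] on a set of measure [2^-K]; its
   [p]-th root is an unbounded function of L_p. *)
Let Y (u : I) : R := limn (h ^~ u).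

Let cvg_h u : h ^~ u @ \oo --> Y u.
Proof.
have [N hN] := h_stat u.
have : h ^~ u @ \oo --> h N u.
  by apply: cvg_near_cst; near=> n; apply: hN; near: n; exact: nbhs_infty_ge.
by move=> hcvg; rewrite /Y (cvg_lim _ hcvg).
Unshelve. all: by end_near. Qed.

Let h_le_Y n u : h n u <= Y u.
Proof. exact: (nondecreasing_cvgn_le (@h_nd u) (cvgP _ (@cvg_h u)) n). Qed.

Let mh n : measurable_fun setT (h n).
Proof. by apply: measurable_sum => k; exact: measurable_indic. Qed.

Let mY : measurable_fun setT Y.
Proof.
by apply: (@measurable_fun_cvg _ _ _ setT h) => // u _; exact: cvg_h.
Qed.

Let Y_ge0 u : 0 <= Y u.
Proof. by rewrite (le_trans _ (h_le_Y 0 u))// /h big_geq. Qed.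

Let Y_gt K u : A K u -> K%:R < Y u.
Proof.
(* The sets decrease, so on [A K] the terms of index 0 to [K] all equal 1 and sum to [K + 1]. *)
move=> AKu; apply: lt_le_trans (h_le_Y K.+1 u); rewrite /h.
rewrite big_nat (eq_bigr (fun _ => 1)); last first.
  move=> k /andP[_ kK]; rewrite indicE mem_set//; case/andP: AKu => u0 uK.
  rewrite /A /= u0 (lt_le_trans uK)//.
  by rewrite ler_wiXn2l// ?invr_ge0// invf_le1// ler1n.
by rewrite -big_nat big_const_nat iter_addr_0 subn0 ltr_nat.
Qed.

Let UA k : (U (A k) <= (2^-1 ^+ k)%:E)%E.
Proof.
rewrite -(@ui_uniform_lt R (2^-1 ^+ k)).
  by rewrite le_measure ?inE//; [exact: measurable_ui_lt|move=> u /andP[]].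
by rewrite exprn_ge0 ?invr_ge0//= exprn_ile1// ?invr_ge0// invf_le1// ler1n.
Qed.

(** Monotone convergence, with the partial sums bounded by a geometric series of ratio 1/2. *)
Let int_Y : (\int[U]_u (Y u)%:E <= 2%:E)%E.
Proof.
have hE n : (\int[U]_u (h n u)%:E = \sum_(0 <= k < n) U (A k))%E.
  under eq_integral do rewrite /h -sumEFin.
  rewrite ge0_integral_sum//; last first.
    by move=> k; apply/measurable_EFinP; exact: measurable_indic.
  by apply: eq_bigr => k _; rewrite integral_indic// setIT.
apply: (@le_integral_nondecreasing_lim _ _ _ U setT h Y) => // n.
  apply/integrableP; split; first exact/measurable_EFinP.
  rewrite (eq_integral (fun u => (h n u)%:E)); last first.
    by move=> u _; rewrite /= ger0_norm// /h sumr_ge0.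
  rewrite hE; apply/lte_sum_pinfty => k _.
  by rewrite (le_lt_trans (probability_le1 _ _))// ltry.
rewrite hE; apply: (@le_trans _ _ (\sum_(0 <= k < n) (2^-1 ^+ k)%:E)%E).
  by apply: lee_sum => k _; exact: UA.
rewrite sumEFin lee_fin.
have := @geometric_seriesE R 1 2^-1.
rewrite lt_eqF ?invf_lt1 ?ltr1n// => /(_ isT).
move/(congr1 (@^~ n)); rewrite /series /= => e.
have -> : \sum_(0 <= k < n) 2^-1 ^+ k = 1 * (1 - 2^-1 ^+ n) / (1 - 2^-1) :> R.
  by rewrite -e; apply: eq_bigr => k _; rewrite mul1r.
have -> : 1 - 2^-1 = 2^-1 :> R by lra.
have : 0 <= (2^-1 : R) ^+ n by rewrite exprn_ge0.
by rewrite invrK mul1r; lra.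
Qed.

Lemma exists_unbounded_Lfun (p : R) (p1 : (1 <= p%:E)%E) :
  exists Z : LfunType U p1,
    forall K : R, (cdf (Z : {RV U >-> R}) K < 1)%E.
Proof.
have p_gt0 : 0 < p by rewrite lee_fin in p1; exact: lt_le_trans p1.
pose f u := Y u `^ p^-1.
have mf : measurable_fun setT f.
  exact: (measurableT_comp (measurable_powR _)).
have ff : f \in Lfun U p%:E.
  rewrite inE; apply/andP; split; rewrite inE//= /finite_norm unlock.
  apply: poweR_lty; apply: (@le_lt_trans _ _ 2%:E); last exact: ltry.
  rewrite (eq_integral (fun u => (Y u)%:E))// => u _.
  rewrite /= ger0_norm ?powR_ge0// -powRrM mulVf ?gt_eqF// powRr1//.
exists (Lfun_Sub p1 ff) => K.
(* Chosen so that [|K|^p < k]: on [A k] this gives [Y > |K|^p], hence [f > K]. *)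
pose k := (Num.truncn (`|K| `^ p)).+1.
have p_neq0 : p != 0 by rewrite gt_eqF.
have fK u : A k u -> K < f u.
  move=> /Y_gt kY; rewrite (le_lt_trans (ler_norm K))//.
  rewrite -[X in X < _](powRr1 (normr_ge0 K)) -(divff p_neq0) powRrM.
  rewrite gt0_ltr_powR ?invr_gt0 ?nnegrE ?powR_ge0 ?Y_ge0//.
  by rewrite (lt_trans _ kY)// truncnS_gt.
rewrite /cdf /distribution /pushforward.
pose N : set I := [set u | ui_val u = 0].
have UN : U N = 0%E by exact: ui_uniform_eq0.
pose V : set I := [set u | ui_val u < 2^-1 ^+ k].
have mV : measurable V by exact: measurable_ui_lt.
apply: (@le_lt_trans _ _ (U (N `|` ~` V))).
  rewrite le_measure ?inE//.
  - rewrite -[X in measurable X]setTI; apply: mf => //.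
  - apply: measurableU; first exact: measurable_ui_eq.
    by apply: measurableC; exact: measurable_ui_lt.
  - move=> u /=; rewrite in_itv /= => fuK.
    have /andP[] := ui_val_itv u.
    rewrite le_eqVlt => /predU1P[u0 _|u0 _]; first by left.
    right; rewrite /setC /mkset => uk.
    have := fK u; rewrite /A /= u0 uk => /(_ isT).
    by rewrite ltNge fuK.
have k01 : 0 <= (2^-1 : R) ^+ k <= 1.
  by rewrite exprn_ge0 ?invr_ge0//= exprn_ile1// ?invr_ge0// invf_le1// ler1n.
have le2 : (U (N `|` ~` V) <= U N + U (~` V))%E.
  by apply: measureU2; [exact: measurable_ui_eq|exact: measurableC].
have UV : U (~` V) = (1 - 2^-1 ^+ k)%:E.
  by rewrite probability_setC// EFinB; congr (_ - _)%E; exact: ui_uniform_lt.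
by rewrite (le_lt_trans le2)// UN add0e UV lte_fin gtrBl exprn_gt0.
Qed.

End unbounded_Lp_function.

(** * Mixtures of average values at risk over the closure *)

Lemma Rintegral_probability_cst d (T : measurableType d) (R : realType)
  (P : probability T R) (c : R) : \int[P]_x cst c x = c.
Proof.
transitivity (c * fine (P setT)); first exact: Rintegral_cst.
by rewrite probability_setT mulr1.
Qed.

Section Kusuoka_closure.
Variables (R : realType) (p : R) (p1 : (1 <= p%:E)%E).
Local Notation I := (unit_interval R).
Implicit Types (Z : LfunType (ui_uniform R) p1) (mu nu : probability I R).
Implicit Type M : set (probability I R).

Let D : set I := [set u | ui_val u < 1].

Let mD : measurable D. Proof. exact: measurable_ui_lt. Qed.

(** The value of [AVaR] at 1 is 0, so removing that point leaves the integral unchanged for every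
    [mu]. *)
Let mixed_AVaR_fineE mu Z :
  mixed_AVaR mu Z = (\int[mu]_(u in D) (fine (AVaR (ui_val u) Z))%:E)%E.
Proof.
rewrite /mixed_AVaR [RHS]integral_mkcond; congr (integral _ _ _).
apply/funext => u; rewrite /patch; have /andP[u0 u1] := ui_val_itv u.
case: ifPn => [/set_mem Du|/negP uD]; first by rewrite AVaRE ?u0//.
have -> : ui_val u = 1; last by rewrite AVaR1.
apply/eqP; rewrite eq_le u1 leNgt; apply/negP => Du.
by apply: uD; exact: mem_set.
Qed.

(** The truncation need not vanish at 1; here the absence of mass at 1 is what allows removing the
    point. *)
Let Rintegral_fineE mu Z n : frakP mu ->
  (\int[mu]_u AVaR_trunc Z n u)%:E =
  (\int[mu]_(u in D) (AVaR_trunc Z n u)%:E)%E.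
Proof.
move=> mu1.
have intZ := integrable_continuous_ui mu
  (@continuous_AVaR_trunc _ _ _ _ _ _ Z n).
rewrite /Rintegral fineK; last exact: integrable_fin_num.
rewrite (negligible_integral (measurable_ui_eq 1) measurableT intZ)//.
congr (integral _ _ _); apply/seteqP; split => u /=.
  by case=> _ /eqP u1; rewrite /D /= lt_neqAle u1; have /andP[] := ui_val_itv u.
by move=> Du; split => // u1; move: Du; rewrite /D /= u1 ltxx.
Qed.

(** With [Rintegral_AVaR_trunc_le], this makes [mixed_AVaR] the supremum of integrals of continuous
    nondecreasing functions. *)
Lemma mixed_AVaR_le mu Z (c : R) : frakP mu ->
  (forall n, \int[mu]_u AVaR_trunc Z n u <= c) -> (mixed_AVaR mu Z <= c%:E)%E.
Proof.
move=> mu1 hc; rewrite mixed_AVaR_fineE.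
apply: (@le_integral_nondecreasing_lim _ _ _ mu D (AVaR_trunc Z)) => //.
- move=> n; apply: integrableS (integrable_continuous_ui mu _) => //.
  exact: continuous_AVaR_trunc.
- by move=> u _; exact: AVaR_trunc_ndn.
- by move=> u; exact: cvg_AVaR_trunc.
- by move=> n; rewrite -Rintegral_fineE// lee_fin.
Qed.

Lemma Rintegral_AVaR_trunc_le mu Z n : frakP mu ->
  ((\int[mu]_u AVaR_trunc Z n u)%:E <= mixed_AVaR mu Z)%E.
Proof.
move=> mu1; rewrite mixed_AVaR_fineE Rintegral_fineE//.
have mtrunc m : measurable_fun D (AVaR_trunc Z m).
  apply: measurable_funTS; apply: measurable_continuous_ui.
  exact: continuous_AVaR_trunc.
apply: measurable_le_integral => //; first exact/measurable_EFinP.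
  apply/measurable_EFinP; apply: (measurable_fun_cvg mtrunc) => u.
  exact: cvg_AVaR_trunc.
move=> u Du; rewrite lee_fin.
have cvgu := cvg_AVaR_trunc (Z := Z) Du.
rewrite -(cvg_lim _ cvgu)//.
have ndu := @AVaR_trunc_ndn _ _ _ _ _ _ Z u.
exact: (nondecreasing_cvgn_le ndu (cvgP _ cvgu) n).
Qed.

Lemma fsd_mixed_AVaR_le mu nu Z : frakP mu -> frakP nu -> fsd mu nu ->
  (mixed_AVaR mu Z <= mixed_AVaR nu Z)%E.
Proof.
move=> mu1 nu1 munu.
have le_trunc n : \int[mu]_u AVaR_trunc Z n u <= \int[nu]_u AVaR_trunc Z n u.
  apply: fsd_Rintegral_le munu; first exact: continuous_AVaR_trunc.
  by move=> u v; exact: AVaR_trunc_nd.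
have := Rintegral_AVaR_trunc_le Z 0 nu1.
move: (@Rintegral_AVaR_trunc_le nu Z ^~ nu1).
(* The value -oo is excluded by the real lower bound given by the truncation of index 0; +oo is a
   trivial bound. *)
case: (mixed_AVaR nu Z) => [c||] // lec _.
  by apply: mixed_AVaR_le => // n; rewrite (le_trans (le_trunc n))// -lee_fin.
by rewrite leey.
Qed.

Variables (rho : LfunType (ui_uniform R) p1 -> R) (M : set (probability I R)).
Hypothesis KM : Kusuoka_set rho M.

Let mixed_le_rho mu Z : M mu -> (mixed_AVaR mu Z <= (rho Z)%:E)%E.
Proof. by move=> Mmu; rewrite KM.2; apply: ereal_sup_ubound; exists mu. Qed.

Let closure_trunc_le mu Z n : closure (M : set (weak_probability R)) mu ->
  \int[mu]_u AVaR_trunc Z n u <= rho Z.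
Proof.
move=> clmu; apply: (closure_Rintegral_le _ _ clmu).
  exact: continuous_AVaR_trunc.
move=> nu Mnu; rewrite -lee_fin (le_trans _ (mixed_le_rho _ Mnu))//.
by apply: Rintegral_AVaR_trunc_le; exact: KM.1.
Qed.

(* For [Z] with [AVaR a Z] unbounded as [a] tends to [1], the bound [rho Z] on
   the integrals of the truncations leaves no room for mass at [1]. *)
Lemma closure_frakP mu : closure (M : set (weak_probability R)) mu -> frakP mu.
Proof.
move=> clmu; have [Z Zlt1] := exists_unbounded_Lfun p1.
rewrite /frakP /=; set N := [set _ | _].
have mN : measurable N by exact: measurable_ui_eq.
have Nfin : mu N \is a fin_num by exact: fin_num_measure.
pose one : I := ui_clamp 1.
have one1 : ui_val one = 1 by rewrite ui_clampE clamp01_id// ler01 lexx.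
(* The least value of all truncations, since they increase in both [n] and [u]. *)
pose c0 := AVaR_trunc Z 0 (ui_clamp 0).
have c0_le n u : c0 <= AVaR_trunc Z n u.
  apply: (@le_trans _ _ (AVaR_trunc Z n (ui_clamp 0))).
    exact: AVaR_trunc_ndn.
  apply: AVaR_trunc_nd; rewrite ui_clampE clamp01_id ?lexx ?ler01//.
  by have /andP[] := ui_val_itv u.
have indint : mu.-integrable setT (EFin \o (\1_N : I -> R)).
  exact: integrable_indic.
(* The truncation is bounded below by [c0], raised on [N] to its value at 1; integrating gives the
   inequality. *)
have massle n : (AVaR_trunc Z n one - c0) * fine (mu N) <= rho Z - c0.
  set c1 := AVaR_trunc Z n one - c0.
  have int1 : mu.-integrable setT (EFin \o (fun u => c1 * \1_N u)).
    exact: (integrableZl measurableT c1 indint).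
  have int0 : mu.-integrable setT (EFin \o (cst c0 : I -> R)).
    exact: finite_measure_integrable_cst.
  have -> : c1 * fine (mu N) = \int[mu]_u (c1 * \1_N u).
    by rewrite RintegralZl// /Rintegral integral_indic// setIT.
  rewrite lerBrDr; apply: le_trans (closure_trunc_le Z n clmu).
  have -> : c0 = \int[mu]_u cst c0 u.
    by rewrite Rintegral_probability_cst.
  rewrite -RintegralD//; apply: le_Rintegral => //.
  - exact: (integrableD measurableT int1 int0).
  - by apply: integrable_continuous_ui; exact: continuous_AVaR_trunc.
  move=> u _; rewrite indicE; case: (boolP (u \in N)) => [/set_mem Nu|_] /=.
    by rewrite mulr1 /c1 subrK (_ : u = one)//; apply: ui_val_inj; rewrite one1.
  by rewrite mulr0 add0r.
have unb K : exists n, K <= AVaR_trunc Z n one.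
  (* A level below 1 whose quantile is at least [K]; the maximum with 1/2 keeps it positive. Then
     [n] is taken so that the cut lies beyond [a]. *)
  pose a : R := Num.max 2^-1 (fine (cdf (Z : {RV ui_uniform R >-> R}) K)).
  have Ffin : cdf (Z : {RV ui_uniform R >-> R}) K \is a fin_num.
    exact: fin_num_measure.
  have a01 : 0 < a < 1.
    rewrite lt_max invr_gt0 ltr0n/= gt_max invf_lt1 ?ltr1n//=.
    by rewrite -lte_fin fineK//; exact: Zlt1.
  have Ka : K <= real_quantile Z a.
    rewrite -lee_fin fineK ?gen_inverse_fin_num//; apply: gen_inverse_ge.
    by rewrite -(fineK Ffin) lee_fin le_max lexx orbT.
  have /andP[a0 a1] := a01; have a1' : 0 < 1 - a by rewrite subr_gt0.
  have /filter_ex[n /= na] := near_infty_natSinv_lt (PosNum a1').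
  exists n; rewrite /AVaR_trunc one1 min_r; last by rewrite gerBl invr_ge0.
  have intq := integrable_real_quantile Z.
  have ndq := @real_quantile_nd _ _ _ _ _ _ Z.
  rewrite (le_trans Ka)// (le_trans (le_tail_mean intq ndq a01))//.
  have {}na : n.+1%:R^-1 < 1 - a by exact: na.
  apply: tail_mean_nd => //; first exact: ltW.
    by rewrite lerBrDr -lerBrDl ltW.
apply/eqP; rewrite -(fineK Nfin) eqe eq_le fine_ge0// andbT leNgt.
apply/negP => m0.
(* With this threshold, multiplying by the mass exceeds [rho Z - c0] by the mass itself, against
   [massle]. *)
have [n] := unb (c0 + ((rho Z - c0) / fine (mu N) + 1)).
rewrite -lerBrDl => /(ler_wpM2r (ltW m0)) /le_trans /(_ (massle n)).
by rewrite mulrDl mul1r divfK ?gt_eqF// gerDl leNgt m0.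
Qed.

Lemma mixed_AVaR_closure_le mu Z : closure (M : set (weak_probability R)) mu ->
  (mixed_AVaR mu Z <= (rho Z)%:E)%E.
Proof.
move=> clmu; apply: mixed_AVaR_le => [|n]; first exact: closure_frakP.
exact: closure_trunc_le.
Qed.

End Kusuoka_closure.

(** * Undominated measures above a given one *)

Section maximal_dominating_measure.
Variable R : realType.
Local Notation I := (unit_interval R).
Variable M : set (probability I R).

Lemma ui_mean_le1 (mu : probability I R) : ui_mean mu <= 1.
Proof.
have -> : 1 = \int[mu]_u cst (1 : R) u.
  by rewrite Rintegral_probability_cst.
apply: le_Rintegral => //.
- by apply: integrable_continuous_ui; exact: continuous_ui_val.
- exact: finite_measure_integrable_cst.
- by move=> u _; have /andP[] := ui_val_itv u.
Qed.

Lemma fsd_near_maximal (mu : probability I R) (e : R) : M mu -> 0 < e ->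
  exists nu, [/\ M nu, fsd mu nu &
    forall xi, M xi -> fsd mu xi -> ui_mean xi <= ui_mean nu + e].
Proof.
move=> Mmu e0; pose S := [set ui_mean xi | xi in [set xi | M xi /\ fsd mu xi]].
have supS : has_sup S.
  split.
    by exists (ui_mean mu); exists mu => //; split => //; exact: fsd_refl.
  by exists 1 => _ [xi _ <-]; exact: ui_mean_le1.
have [_ [nu [Mnu munu] <-] Snu] := sup_adherent e0 supS.
exists nu; split => // xi Mxi muxi; rewrite -lerBlDr.
apply: (le_trans _ (ltW Snu)); rewrite lerD2r.
by apply: ub_le_sup; [exact: supS.2|exists xi].
Qed.

Lemma exists_fsd_maximal (mu : probability I R) : M mu ->
  exists nu, [/\ closure (M : set (weak_probability R)) nu, fsd mu nu &
    ~ exists2 xi, M xi & fsd_strict nu xi].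
Proof.
move=> Mmu.
(* The index is carried along with the measure because the tolerance [1/(n+1)] of the choice depends
   on it. *)
pose P (nx : nat * {xi | M xi}) (nu : {xi | M xi}) :=
  fsd (sval nx.2) (sval nu) /\ forall xi, M xi -> fsd (sval nx.2) xi ->
    ui_mean xi <= ui_mean (sval nu) + nx.1.+1%:R^-1.
have [next nextP] : {next & forall nx, P nx (next nx)}.
  apply: choice => -[n [nu Mnu]].
  have n0 : 0 < n.+1%:R^-1 :> R by rewrite invr_gt0.
  have [xi [Mxi nuxi xiP]] := fsd_near_maximal Mnu n0.
  by exists (exist _ xi Mxi).
pose mus := fix mus n :=
  if n is n'.+1 then next (n', mus n') else exist _ mu Mmu.
pose mu_ n := sval (mus n).
have fsd_mu_ n : fsd (mu_ n) (mu_ n.+1) by have [] := nextP (n, mus n).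
pose lim := fsd_limit fsd_mu_.
exists lim; split.
- by apply: closure_fsd_limit => n; exact: (svalP (mus n)).
- exact: (fsd_fsd_limit fsd_mu_ 0).
case=> xi Mxi [limxi]; apply; apply: fsd_ui_mean_measure_eq => //.
(* An element [xi] above the limit is above every [mu_ n], so its mean exceeds that of [mu_ n.+1],
   hence that of the limit, by at most [1/(n+1)]. *)
apply/ler_addgt0Pr => e e0.
have /filter_ex[n /= ne] := near_infty_natSinv_lt (PosNum e0).
have [_ /(_ xi Mxi) nxi] := nextP (n, mus n).
apply: (le_trans (nxi _)).
  exact: fsd_trans (fsd_fsd_limit fsd_mu_ n) limxi.
rewrite lerD//; last exact: ltW.
apply: fsd_Rintegral_le; [exact: continuous_ui_val|by []|].
exact: (fsd_fsd_limit fsd_mu_ n.+1).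
Qed.

End maximal_dominating_measure.

(** * The augmented set and the set of undominated measures *)

Theorem theorem4p1 (R : realType) (p : R) (p1 : (1 <= p%:E)%E)
    (rho : LfunType (ui_uniform R) p1 -> R)
    (M : set (probability (unit_interval R) R)) :
  coherent_risk_measure rho ->
  law_invariant rho ->
  Kusuoka_set rho M ->
  Kusuoka_set rho
    [set mu' | @frakP R mu' /\ exists2 mu, M mu & fsd mu' mu] /\
  Kusuoka_set rho
    [set mu | frakP_closure M mu /\ ~ exists2 nu, M nu & fsd_strict mu nu].
Proof.
move=> _ _ KM; have [MP rhoE] := KM; split; split.
- by move=> mu [].
- move=> Z; apply/eqP; rewrite eq_le; apply/andP; split.
    rewrite rhoE; apply: le_ereal_sup => _ [mu Mmu <-]; exists mu => //.
    by split; [exact: MP|exists mu => //; exact: fsd_refl].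
  apply: ge_ereal_sup => _ [mu' [mu'P [mu Mmu mu'mu]] <-].
  apply: (le_trans (fsd_mixed_AVaR_le Z mu'P (MP _ Mmu) mu'mu)).
  by rewrite rhoE; apply: ereal_sup_ubound; exists mu.
- by move=> mu [[]].
- move=> Z; apply/eqP; rewrite eq_le; apply/andP; split.
    rewrite rhoE; apply: ge_ereal_sup => _ [mu Mmu <-].
    (* Replacing [mu] by an undominated [nu] above it can only raise the mixture, so the second set
       loses nothing of the supremum. *)
    have [nu [clnu munu numax]] := exists_fsd_maximal Mmu.
    have nuP : frakP nu := closure_frakP KM clnu.
    apply: (le_trans (fsd_mixed_AVaR_le Z (MP _ Mmu) nuP munu)).
    by apply: ereal_sup_ubound; exists nu.
  apply: ge_ereal_sup => _ [mu [[clmu _] _] <-].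
  exact: (mixed_AVaR_closure_le KM).
Qed.
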